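(* Let $p\in[1,\infty)$, let $(\Omega,\mathcal{F},\mathbb{P})$ be a probability space, and let $\mathcal{F}_0\subset\mathcal{F}_1\subset\cdots\subset\mathcal{F}$ be an increasing sequence of sub-$\sigma$-algebras such that $\mathcal{F}_\infty=\sigma\left(\bigcup_{k\ge0}\mathcal{F}_k\right)$ coincides with $\mathcal{F}$ up to $\mathbb{P}$-null sets. For $f\in L^p(\Omega,\mathbb{P})$ and $k=0,1,2,\ldots$, set $E_kf:=\mathbb{E}[f\mid\mathcal{F}_k]$. Then, for every $f\in L^p(\Omega,\mathbb{P})$, $$\lim_{\beta\to0^+}(1-e^{-\beta})\sum_{k=0}^\infty e^{-\beta k}\|E_kf\|_{L^p(\mathbb{P})}^p=\|f\|_{L^p(\mathbb{P})}^p .$$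
   Context: $\mathbb{E}[f\mid\mathcal{F}_k]$ denotes conditional expectation with respect to $\mathcal{F}_k$ under $\mathbb{P}$, and $\|\cdot\|_{L^p(\mathbb{P})}$ is the norm of $L^p(\Omega,\mathbb{P})$. *)

(* Defs.v *)
From HB Require Import structures.
From mathcomp Require Import all_boot all_order all_algebra.
From mathcomp Require Import all_classical all_reals all_analysis.

Set Implicit Arguments.
Unset Strict Implicit.
Unset Printing Implicit Defensive.

Import Order.TTheory GRing.Theory Num.Theory.
Import numFieldNormedType.Exports.

Local Open Scope classical_set_scope.
Local Open Scope ring_scope.
Local Open Scope ereal_scope.

Record is_filtration d (T : measurableType d) (F : nat -> set (set T)) : Prop :=
  { filtration_sigma_algebra : forall k, sigma_algebra setT (F k) ;
    filtration_measurable : forall k, F k `<=` measurable ;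
    filtration_nondecreasing : forall m n, (m <= n)%N -> F m `<=` F n }.

(* The reverse inclusion is not required: it is automatic when G consists of
   measurable sets. *)
Definition generates_mod_null d (T : measurableType d) (R : realType)
    (P : probability T R) (G : set (set T)) : Prop :=
  forall A, measurable A -> exists2 B, <<s G >> B & P (A `+` B) = 0.

(* [g] is a version of E[f | G], for an integrable [f] and a
   sub-sigma-algebra [G]; the measurable sets of [g_sigma_algebraType G] are
   those of <<s G >>, which is [G] itself when [G] is a sigma-algebra. *)
Record is_cond_exp d (T : measurableType d) (R : realType)
    (P : probability T R) (G : set (set T)) (f g : T -> R) : Prop :=
  { cond_exp_measurable :
      measurable_fun setT (g : g_sigma_algebraType G -> R) ;
    cond_exp_integrable : P.-integrable setT (EFin \o g) ;
    cond_exp_integral : forall A, G A ->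
      \int[P]_(x in A) (g x)%:E = \int[P]_(x in A) (f x)%:E }.

(* Main.v *)
(* Write a_k = ||E_k f||_p^p and L = ||f||_p^p. The tangent line inequality for
   t |-> t^p, integrated against a bounded F_k-measurable weight, shows that
   conditional expectation contracts the L^p norm, so a_k <= L. The functions
   that are measurable for some F_k are dense in L^p; if h is one of them, close
   to f, then E_m f - h is a version of E[f - h | F_m] for all large m, hence
   ||E_m f||_p >= ||f||_p - 2 ||f - h||_p and a_m -> L. Since a_k <= L, bounding
   the Abel mean from below only requires discarding finitely many terms. *)

Require Import Defs.
From HB Require Import structures.
From mathcomp Require Import all_boot all_order all_algebra.
From mathcomp Require Import all_classical all_reals all_analysis.
From mathcomp Require Import measurable_realfun.
From mathcomp Require Import ring lra.

Import Order.TTheory GRing.Theory Num.Theory.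
Import numFieldNormedType.Exports.

Local Open Scope classical_set_scope.
Local Open Scope ring_scope.
Local Open Scope ereal_scope.

Set Implicit Arguments.
Unset Strict Implicit.

(** * Tangent line inequality and Abel means *)

(** Young's inequality for [a] and [b^(p-1)] with the conjugate exponents [p] and [p/(p-1)],
    multiplied by [p]. The second exponent degenerates at [p = 1], so that case is split off; there
    both sides equal [a]. *)
Lemma powR_tangent (R : realType) (p a b : R) :
  (1 <= p -> 0 <= a -> 0 <= b ->
   p * b `^ (p - 1) * a <= a `^ p + (p - 1) * b `^ p)%R.
Proof.
rewrite le_eqVlt => /predU1P[<-|p1] a0 b0.
  by rewrite subrr powRr0 mul0r addr0 powRr1// !mul1r.
have p0 : (0 < p)%R by apply: lt_trans p1.
have pm0 : (0 < p - 1)%R by rewrite subr_gt0.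
have pn0 : p != 0%R by rewrite gt_eqF.
have pmn0 : (p - 1 != 0)%R by rewrite gt_eqF.
have := @conjugate_powR _ a (b `^ (p - 1))%R p (p / (p - 1))%R a0 (powR_ge0 _ _) p0.
rewrite divr_gt0// => /(_ isT).
have -> : (p^-1 + (p / (p - 1))^-1 = 1)%R by field; apply/andP.
move=> /(_ erefl); rewrite -powRrM.
have -> : ((p - 1) * (p / (p - 1)) = p)%R by field.
rewrite -(ler_pM2l p0) => /le_trans; rewrite -mulrA (mulrC _ a); apply.
rewrite le_eqVlt; apply/orP; left; apply/eqP.
by field; apply/andP.
Qed.

Lemma nneseries_geometric_tail (R : realType) (r : R) (N : nat) :
  (0 <= r < 1)%R ->
  \sum_(N <= k <oo) (r ^+ k)%:E = (r ^+ N / (1 - r))%:E.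
Proof.
move=> /andP[r0 r1]; rewrite -nneseries_addn; last first.
  by move=> i; rewrite lee_fin exprn_ge0.
apply/cvg_lim => //; apply: cvg_EFin.
  by apply: nearW => n; rewrite sumEFin.
have := @cvg_geometric_series _ (r ^+ N)%R r.
rewrite ger0_norm// => /(_ r1); apply: cvg_trans.
apply: near_eq_cvg; apply: nearW => n /=.
rewrite sumEFin /= /series/= /geometric/=.
by apply: eq_bigr => i _; rewrite exprD mulrC.
Qed.

(** With [r = exp(-beta)], the weights [(1 - r) r^k] have total mass 1 and mass [r^N] on the indices
    [k >= N]. So the mean is at most [L], and at least [c r^N] when [c >= 0] bounds the tail of [a]
    from below; [r^N] tends to 1 as [beta] tends to 0. *)
Lemma abel_mean_cvg (R : realType) (a : nat -> \bar R) (L : R) :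
  (forall k, 0 <= a k) -> (forall k, a k <= L%:E) ->
  (forall e, (0 < e)%R -> exists N, forall k, (N <= k)%N -> (L - e)%:E <= a k) ->
  (1 - expR (- beta))%:E *
    (\sum_(0 <= k <oo) (expR (- beta * k%:R))%:E * a k)
    @[beta --> (0%R : R)^'+] --> L%:E.
Proof.
move=> a0 aL La.
pose r beta : R := expR (- beta).
have rk beta k : expR (- beta * k%:R) = (r beta ^+ k)%R by rewrite expRM_natr.
have r01 beta : (0 < beta)%R -> (0 < r beta < 1)%R.
  by move=> b0; rewrite expR_gt0/= -expR0 ltr_expR oppr_lt0.
pose S beta := (1 - r beta)%:E * (\sum_(0 <= k <oo) (r beta ^+ k)%:E * a k).
rewrite [X in X @ _](_ : _ = S); last first.
  by apply/funext => beta; rewrite /S; under eq_eseriesr do rewrite rk.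
have tail0 beta k : (0 < beta)%R -> 0 <= (r beta ^+ k)%:E * a k.
  by move=> /r01/andP[/ltW ? _]; rewrite mule_ge0// lee_fin exprn_ge0.
have mulK beta c N : (0 < beta)%R ->
    (1 - r beta)%:E * (c%:E * \sum_(N <= k <oo) (r beta ^+ k)%:E) =
    (c * r beta ^+ N)%:E.
  move=> /r01/andP[b0 b1]; rewrite nneseries_geometric_tail ?(ltW b0)//.
  rewrite -!EFinM; congr EFin; field.
  by rewrite subr_eq0 gt_eqF.
have L0 : (0 <= L)%R by rewrite -lee_fin (le_trans (a0 0%N)).
have SL beta : (0 < beta)%R -> S beta <= L%:E.
  move=> b0; have /andP[r0 r1] := r01 _ b0.
  have -> : L%:E = (1 - r beta)%:E * (L%:E * \sum_(0 <= k <oo) (r beta ^+ k)%:E).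
    by rewrite mulK// expr0 mulr1.
  rewrite lee_pmul2l ?lte_fin ?subr_gt0// -nneseriesZl; last first.
    by move=> i _; rewrite lee_fin exprn_ge0// ltW.
  apply: lee_nneseries => [i _ _|k _]; first exact: tail0.
  by rewrite muleC lee_pmul2r// lte_fin exprn_gt0.
have LS beta c N : (0 < beta)%R -> (0 <= c)%R ->
    (forall k, (N <= k)%N -> c%:E <= a k) -> (c * r beta ^+ N)%:E <= S beta.
  move=> b0 c0 ca; have /andP[r0 r1] := r01 _ b0.
  rewrite -mulK// lee_pmul2l ?lte_fin ?subr_gt0// -nneseriesZl; last first.
    by move=> i _; rewrite lee_fin exprn_ge0// ltW.
  rewrite [leRHS](@nneseries_split _ _ 0 N); last by move=> k _; exact: tail0.
  rewrite add0n (@le_trans _ _ (\sum_(N <= k <oo) ((r beta ^+ k)%:E * a k)))//.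
    rewrite -(@nneseries_addn _ (fun k => c%:E * (r beta ^+ k)%:E) N); last first.
      by move=> k; rewrite mule_ge0// lee_fin exprn_ge0// ltW.
    rewrite -(@nneseries_addn _ (fun k => (r beta ^+ k)%:E * a k) N); last first.
      by move=> k; exact: tail0.
    apply: lee_nneseries => [i _ _|k _]; rewrite muleC.
      by rewrite mule_ge0// lee_fin exprn_ge0// ltW.
    by rewrite lee_pmul2l ?lte_fin ?exprn_gt0// ca// leq_addl.
  rewrite leeDr//; apply: sume_ge0 => k _; exact: tail0.
(* The bounds 0 and [L] make the mean finite for [beta > 0], so the limit can be treated as one of
   real numbers. *)
have Sfin : \forall beta \near (0%R : R)^'+, S beta \is a fin_num.
  near=> beta; rewrite ge0_fin_numE.
    by rewrite (le_lt_trans (SL _ _))// ltry.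
  rewrite (le_trans _ (LS beta 0%R 0%N _ _ _)) ?mul0r//.
apply: cvg_EFin => //; apply/cvgrPdist_le => e e0.
have e20 : (0 < e / 2)%R by rewrite divr_gt0.
have [N LN] := La _ e20.
(* [L - e / 2] may be negative while [LS] asks for a nonnegative constant. The maximum with 0 still
   bounds the tail from below because [a] is nonnegative. *)
pose c := Num.max 0%R (L - e / 2)%R.
have c0 : (0 <= c)%R by rewrite le_max lexx.
have ca k : (N <= k)%N -> c%:E <= a k.
  by move=> Nk; rewrite /c EFin_max ge_max a0 LN.
have : (c * r beta ^+ N)%R @[beta --> (0%R : R)^'+] --> c.
  rewrite -[X in _ --> X]mulr1 -(expr1n _ N).
  apply: cvgM; first exact: cvg_cst.
  apply: (@cvg_comp _ _ _ r (fun x => x ^+ N)%R _ (nbhs (1%R : R))); last first.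
    exact: exprn_continuous.
  rewrite -[1%R]expR0 -[in expR _]oppr0; apply: cvg_at_right_filter.
  apply: continuous_comp; [exact: opp_continuous|exact: continuous_expR].
move=> /cvgrPdist_le/(_ _ e20) crN.
near=> beta.
have b0 : (0 < beta)%R by [].
have Sb : S beta \is a fin_num by near: beta.
have := SL _ b0; have := LS _ _ _ b0 c0 ca.
have : (`|c - c * r beta ^+ N| <= e / 2)%R by near: beta.
rewrite -(fineK Sb) !lee_fin !ler_norml /= => /andP[_ h1] h2 h3.
have : (L - e / 2 <= c)%R by rewrite le_max lexx orbT.
by move=> h4; apply/andP; split; lra.
Unshelve. all: by end_near.
Qed.

(** * Functional induction *)

Section functional_induction.
Import HBSimple HBNNSimple.

Lemma nnsfun_ind d (T : measurableType d) (R : realType) (H : (T -> R) -> Prop) :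
  (forall A, measurable A -> H \1_A) ->
  (forall f g, H f -> H g -> H (f \+ g)%R) ->
  (forall c f, H f -> H (fun x => c * f x)%R) ->
  forall h : {nnsfun T >-> R}, H h.
Proof.
move=> H1 HD HZ h.
pose s := finmap.enum_fset (fset_set (range h)).
have -> : (h : T -> R) =
    (fun x => \sum_(i < size s) s`_i * \1_(h @^-1` [set s`_i]) x)%R.
  by apply/funext => x; rewrite fimfunEord.
(* Base case of the induction on the number of values: the zero function is obtained by scaling an
   indicator by 0. *)
have H0 : H (fun=> 0%R).
  rewrite (_ : (fun=> 0%R) = (fun x : T => 0 * \1_(@set0 T) x)%R).
    by apply: HZ; apply: H1.
  by apply/funext => x; rewrite mul0r.
elim: (size _) => [|n IH].
  by under eq_fun do rewrite big_ord0.
under eq_fun do rewrite big_ord_recr/=.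
by apply: HD => //; apply: HZ; apply: H1; exact: measurable_sfunP.
Qed.

Lemma nnsfun_approx_real d (T : measurableType d) (R : realType) (f : T -> R) :
  measurable_fun setT f -> (forall x, 0 <= f x)%R ->
  exists f_ : nat -> {nnsfun T >-> R},
    (forall n x, f_ n x <= f x)%R /\ (forall x, f_ ^~ x @ \oo --> f x).
Proof.
move=> mf f0; have mEf : measurable_fun setT (EFin \o f) by exact/measurable_EFinP.
exists (nnsfun_approx measurableT mEf); split => [n x|x].
  by rewrite nnsfun_approxE -lee_fin le_approx// => y _; rewrite lee_fin.
have /fine_cvg// : EFin \o (fun n => nnsfun_approx measurableT mEf n x) @ \oo --> (f x)%:E.
apply: (@cvg_nnsfun_approx _ _ _ _ measurableT _ mEf) => // y _.
by rewrite lee_fin.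
Qed.

(** The positive and negative parts of [f] are limits of simple functions. The limit clause concerns
    only sequences dominated by [|f|] itself, so that an integrability or boundedness assumption on
    [f] controls the whole sequence. *)
Lemma measurable_fun_ind d (T : measurableType d) (R : realType)
    (H : (T -> R) -> Prop) (f : T -> R) :
  (forall A, measurable A -> H \1_A) ->
  (forall f g, H f -> H g -> H (f \+ g)%R) ->
  (forall c f, H f -> H (fun x => c * f x)%R) ->
  measurable_fun setT f ->
  (forall f_ : nat -> T -> R, (forall n, measurable_fun setT (f_ n)) ->
    (forall n, H (f_ n)) -> (forall n x, `|f_ n x| <= `|f x|)%R ->
    (forall x, f_ ^~ x @ \oo --> f x) -> H f) ->
  H f.
Proof.
move=> H1 HD HZ mf Hlim.
have Hs := nnsfun_ind H1 HD HZ.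
have approx (g : T -> R) : measurable_fun setT g ->
    exists g_ : nat -> {nnsfun T >-> R},
      (forall n x, g_ n x <= Num.max (g x) 0)%R /\
      (forall x, g_ ^~ x @ \oo --> Num.max (g x) 0%R).
  move=> mg; apply: nnsfun_approx_real.
    by apply: measurable_maxr => //; exact: measurable_cst.
  by move=> x; rewrite le_max lexx orbT.
have [p_ [p_le p_cvg]] := approx _ mf.
have [n_ [n_le n_cvg]] := approx _ (measurable_funN mf).
(* At each point one of the two parts of [f] vanishes, hence the difference of their approximations
   stays below [|f|] in absolute value. *)
apply: (Hlim (fun n => p_ n \+ (fun x => -1 * n_ n x))%R) => [n|n|n x|x].
- by apply: measurable_funD => //; apply: measurable_funM.
- by apply: HD => //; exact: HZ.
- have := p_le n x; have := n_le n x.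
  have : (0 <= p_ n x)%R by []. have : (0 <= n_ n x)%R by [].
  rewrite /= ler_norml; case: (lerP (f x) 0%R); case: (lerP (- f x) 0%R);
    by case: (ger0P (f x)) => *; apply/andP; split; lra.
- rewrite (_ : f x = Num.max (f x) 0 + (-1) * Num.max (- f x) 0)%R; last first.
    by case: (lerP (f x) 0%R); case: (lerP (- f x) 0%R) => *; lra.
  by apply: cvgD => //; apply: cvgM => //; exact: cvg_cst.
Qed.

End functional_induction.

(** * Contraction of conditional expectations in L^p *)

Lemma measurable_powR_norm d (T : measurableType d) (R : realType) (p : R)
    (f : T -> R) : measurable_fun setT f ->
  measurable_fun setT (fun x => `|f x| `^ p)%R.
Proof.
by move=> mf; apply: (measurableT_comp (measurable_powR p)); exact: measurableT_comp.
Qed.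

Section conditional_expectation.
Context (d : measure_display) (T : measurableType d) (R : realType).
Variable P : probability T R.
Variable G : set (set T).
Hypotheses (sG : sigma_algebra setT G) (mG : G `<=` measurable).
Implicit Types f g h w : T -> R.

Lemma measurable_g_sigma_algebra A :
  measurable (A : set (g_sigma_algebraType G)) -> G A.
Proof.
by move=> mA; have <- : <<s G >> = G by exact: sigma_algebra_id.
Qed.

Lemma measurable_fun_g_sigma_algebra w :
  measurable_fun setT (w : g_sigma_algebraType G -> R) -> measurable_fun setT w.
Proof. by move=> mw _ Y mY; apply: mG; apply: measurable_g_sigma_algebra; exact: mw. Qed.

(** All the products are dominated by [M |f|]. Applied to a constant sequence, this also shows that
    a bounded function times an integrable one is integrable. *)
Lemma dominated_mul_cvg (w_ : nat -> T -> R) w f (M : R) :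
  P.-integrable setT (EFin \o f) ->
  (forall n, measurable_fun setT (w_ n)) -> measurable_fun setT w ->
  (forall n x, `|w_ n x| <= M)%R -> (forall x, w_ ^~ x @ \oo --> w x) ->
  P.-integrable setT (fun x => (w x * f x)%:E) /\
  \int[P]_x (w_ n x * f x)%:E @[n --> \oo] --> \int[P]_x (w x * f x)%:E.
Proof.
move=> intf mw_ mw wM ww.
have /measurable_EFinP mf := measurable_int _ intf.
have [] // := @dominated_convergence _ _ _ P _ measurableT
  (fun n x => (w_ n x * f x)%:E) (fun x => (w x * f x)%:E)
  (fun x => M%:E * `|(f x)%:E|).
- by move=> n; apply/measurable_EFinP/measurable_funM.
- by apply/measurable_EFinP/measurable_funM.
- apply: aeW => x _; apply: cvg_EFin; first exact: nearW.
  by apply: cvgM => //; exact: cvg_cst.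
- by apply: integrableZl => //; exact: integrable_abse.
- by apply: aeW => x n _; rewrite !abse_EFin -EFinM lee_fin normrM ler_wpM2r.
Qed.

(** Functional induction on the weight, run over the sigma-algebra [G]: on indicators the claim is
    the defining identity of [g], and bounded pointwise limits pass through both integrals by
    dominated convergence. *)
Lemma cond_exp_mul f g w (M : R) :
  is_cond_exp P G f g -> P.-integrable setT (EFin \o f) ->
  measurable_fun setT (w : g_sigma_algebraType G -> R) ->
  (forall x, `|w x| <= M)%R ->
  \int[P]_x (w x * g x)%:E = \int[P]_x (w x * f x)%:E.
Proof.
move=> [_ intg gf] intf mw wM.
(* Integrability is part of the invariant because additivity of the integral requires it. *)
pose H (v : T -> R) := [/\ P.-integrable setT (fun x => (v x * f x)%:E),
  P.-integrable setT (fun x => (v x * g x)%:E) &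
  \int[P]_x (v x * g x)%:E = \int[P]_x (v x * f x)%:E].
suff [] : H w by [].
apply: (@measurable_fun_ind _ (g_sigma_algebraType G) R H) (mw) _.
- move=> A /measurable_g_sigma_algebra GA.
  have restr v x : (\1_A x * v x)%:E = ((EFin \o v) \_ A) x.
    by rewrite patchE indicE; case: ifP => _; rewrite ?mul1r ?mul0r.
  have intr v : P.-integrable setT (EFin \o v) ->
      P.-integrable setT (fun x => (\1_A x * v x)%:E).
    move=> iv; rewrite (_ : (fun _ => _) = (EFin \o v) \_ A); last first.
      by apply/funext => x; exact: restr.
    apply/(integrable_mkcond _ (mG GA)).1.
    by apply: integrableS iv => //; exact: (mG GA).
  split; [exact: intr|exact: intr|].
  under eq_integral do rewrite restr.
  under [in RHS]eq_integral do rewrite restr.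
  by rewrite -!integral_mkcond; exact: gf.
- move=> u v [u1 u2 u3] [v1 v2 v3]; rewrite /H.
  have E k : (fun x => ((u \+ v)%R x * k x)%:E) =
      (fun x => (u x * k x)%:E) \+ (fun x => (v x * k x)%:E).
    by apply/funext => x; rewrite /= mulrDl EFinD.
  by rewrite !E; split; [exact: integrableD|exact: integrableD|
    rewrite !integralD// u3 v3].
- move=> c u [u1 u2 u3]; rewrite /H.
  have E k : (fun x => (c * u x * k x)%:E) = (fun x => c%:E * (u x * k x)%:E).
    by apply/funext => x; rewrite -mulrA EFinM.
  by rewrite !E; split; [exact: integrableZl|exact: integrableZl|
    rewrite !integralZl// u3].
- move=> w_ mw_ Hw_ w_w cw.
  have w_M n x : (`|w_ n x| <= M)%R by rewrite (le_trans (w_w _ _)).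
  have mw_T n := measurable_fun_g_sigma_algebra (mw_ n).
  have mwT := measurable_fun_g_sigma_algebra mw.
  have [fw fcvg] := dominated_mul_cvg intf mw_T mwT w_M cw.
  have [gw gcvg] := dominated_mul_cvg intg mw_T mwT w_M cw.
  split => //; apply: (cvg_unique _ gcvg); first exact: ereal_hausdorff.
  apply: cvg_trans fcvg; apply: near_eq_cvg; apply: nearW => n.
  by have [_ _] := Hw_ n.
Qed.


(** Test against the weight [w = p |u|^(p-1) sgn u]. Since [u] is 0 or [g], [w g = p |u|^p], while
    the tangent inequality gives [w f <= |f|^p + (p-1) |u|^p]. Integrating and subtracting [p-1]
    times the integral of [|u|^p] leaves the claim. *)
Lemma cond_exp_bounded_truncation (p : R) f g u (M : R) : (1 <= p)%R ->
  is_cond_exp P G f g -> P.-integrable setT (EFin \o f) ->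
  P.-integrable setT (fun x => (`|f x| `^ p)%:E) ->
  measurable_fun setT (u : g_sigma_algebraType G -> R) ->
  (forall x, `|u x| <= M)%R -> (forall x, u x = 0%R \/ u x = g x) ->
  \int[P]_x (`|u x| `^ p)%:E <= \int[P]_x (`|f x| `^ p)%:E.
Proof.
move=> p1 fg intf intfp mu uM ug.
have p0 : (0 < p)%R by rewrite (lt_le_trans _ p1).
have muT := measurable_fun_g_sigma_algebra mu.
(* w = p |u|^(p-1) sgn u, written without sgn so that it is visibly measurable. *)
pose w x := (p * u x * `|u x| `^ (p - 2))%R.
(* At a zero of [u] the weight is 0, but for [p = 1] the expression [p |u|^(p-1)] is 1 by the
   convention [0^0 = 1]; hence the alternative. *)
have wE x : (`|w x| = p * `|u x| `^ (p - 1))%R \/ (w x = 0 /\ u x = 0)%R.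
  rewrite /w; have [->|u0] := eqVneq (u x) 0%R; first by right; rewrite mulr0 mul0r.
  left; rewrite !normrM (gtr0_norm p0) (ger0_norm (powR_ge0 _ _)) -mulrA; congr *%R.
  rewrite -{1}[`|u x|%R]powRr1// -powRD; last by rewrite normr_eq0 u0 implybT.
  by congr powR; ring.
have wg x : (w x * g x = p * `|u x| `^ p)%R.
  case: (ug x) => ux.
    by rewrite /w ux normr0 mulr0 !mul0r powR0 ?gt_eqF// mulr0.
  rewrite -ux /w; have [->|u0] := eqVneq (u x) 0%R.
    by rewrite normr0 mulr0 powR0 ?gt_eqF// mulr0.
  rewrite -!mulrA; congr *%R; rewrite mulrCA -expr2 -real_normK ?num_real//.
  rewrite -powR_mulrn// -powRD; last by rewrite normr_eq0 u0 implybT.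
  by rewrite subrK.
have wf x : (w x * f x <= `|f x| `^ p + (p - 1) * `|u x| `^ p)%R.
  case: (wE x) => [wx|[-> ux]]; last first.
    by rewrite mul0r ux normr0 powR0 ?gt_eqF// mulr0 addr0 powR_ge0.
  rewrite (le_trans (ler_norm _))// normrM wx.
  exact: powR_tangent.
have wM x : (`|w x| <= p * M `^ (p - 1))%R.
  have M0 : (0 <= M)%R by rewrite (le_trans _ (uM x)).
  case: (wE x) => [->|[-> _]]; last by rewrite normr0 mulr_ge0 ?powR_ge0 ?ltW.
  rewrite ler_pM2l// ge0_ler_powR ?subr_ge0 ?nnegrE//.
have mpow (q : R) : measurable_fun setT (fun x : g_sigma_algebraType G => `|u x| `^ q)%R.
  by apply: (measurableT_comp (measurable_powR q)); exact: measurableT_comp.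
have mw : measurable_fun setT (w : g_sigma_algebraType G -> R).
  apply: measurable_funM => //; exact: measurable_funM.
have mwT := measurable_fun_g_sigma_algebra mw.
(* Finite because [u] is bounded; this is what permits the final subtraction. *)
have intu : P.-integrable setT (fun x => (`|u x| `^ p)%:E).
  apply: (@measurable_bounded_integrable _ _ _ P (fun x => `|u x| `^ p)%R) => //.
  - by rewrite (le_lt_trans (probability_le1 P measurableT))// ltry.
  - exact: (measurable_fun_g_sigma_algebra (mpow p)).
  - exists (M `^ p)%R; split; first exact: num_real.
    move=> N MN x _; rewrite /= ger0_norm ?powR_ge0// (le_trans _ (ltW MN))//.
    by rewrite ge0_ler_powR ?nnegrE ?(le_trans _ (uM x))// ltW.
have intwf : P.-integrable setT (fun x => (w x * f x)%:E).
  by have [] := dominated_mul_cvg intf (fun=> mwT) mwT (fun=> wM) (fun=> cvg_cst _).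
have eqint : p%:E * \int[P]_x (`|u x| `^ p)%:E = \int[P]_x (w x * f x)%:E.
  rewrite -integralZl// -(cond_exp_mul fg intf mw wM).
  by apply: eq_integral => x _; rewrite wg EFinM.
have : \int[P]_x (w x * f x)%:E <=
    \int[P]_x ((`|f x| `^ p)%:E + (p - 1)%:E * (`|u x| `^ p)%:E).
  apply: le_integral => //.
  - exact: (integrableD measurableT intfp (integrableZl measurableT (p - 1) intu)).
  - by move=> x _; rewrite -EFinM -EFinD lee_fin.
rewrite -eqint integralD//; last exact: integrableZl.
rewrite integralZl//.
rewrite -(fineK (integrable_fin_num measurableT intu)).
rewrite -(fineK (integrable_fin_num measurableT intfp)).
by rewrite -!EFinM -EFinD !lee_fin; lra.
Qed.

(** A priori [g] is only integrable, so it is first cut off outside [|g| <= n], where the bound for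
    truncations applies; monotone convergence then removes the cut-off. *)
Lemma cond_exp_Lp_le (p : R) f g : (1 <= p)%R ->
  is_cond_exp P G f g -> P.-integrable setT (EFin \o f) ->
  P.-integrable setT (fun x => (`|f x| `^ p)%:E) ->
  \int[P]_x (`|g x| `^ p)%:E <= \int[P]_x (`|f x| `^ p)%:E.
Proof.
move=> p1 fg intf intfp.
have p0 : (0 < p)%R by rewrite (lt_le_trans _ p1).
have mg := cond_exp_measurable fg.
(* Typed over [g_sigma_algebraType G] so that measurability means membership in [G]: the truncation
   has to remain [G]-measurable. *)
pose A (n : nat) : set (g_sigma_algebraType G) := [set x | `|g x| <= n%:R]%R.
have mA n : measurable (A n).
  have mng : measurable_fun setT (fun x : g_sigma_algebraType G => `|g x|)%R.
    exact: measurableT_comp.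
  rewrite (_ : A n = setT `&` (fun x => `|g x|)%R @^-1` `]-oo, n%:R]%classic).
    by apply: mng => //; exact: measurable_itv.
  by apply/seteqP; split => x; rewrite /A/= in_itv/= => // -[].
pose u n x := (g x * \1_(A n) x)%R.
have mu n : measurable_fun setT (u n : g_sigma_algebraType G -> R).
  by apply: measurable_funM => //; exact: measurable_indic.
have muT n := measurable_fun_g_sigma_algebra (mu n).
have uE n x : u n x = if (`|g x| <= n%:R)%R then g x else 0%R.
  rewrite /u indicE; case: ifPn => gn; first by rewrite mem_set ?mulr1.
  by rewrite memNset ?mulr0//= /A/=; exact/negP.
have u_le n : \int[P]_x (`|u n x| `^ p)%:E <= \int[P]_x (`|f x| `^ p)%:E.
  apply: (@cond_exp_bounded_truncation p f g (u n) n%:R) => // x; rewrite uE.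
    by case: ifP => //; rewrite normr0.
  by case: ifP => _; [right|left].
(* At a fixed point the sequence is constant as soon as [n >= |g x|]. *)
have ucvg x : (`|u n x| `^ p)%:E @[n --> \oo] --> (`|g x| `^ p)%:E.
  apply: cvg_near_cst; near=> n; rewrite uE ifT//.
  near: n; exact: nbhs_infty_ger.
have -> : \int[P]_x (`|g x| `^ p)%:E =
    \int[P]_x (limn (fun n => (`|u n x| `^ p)%:E)).
  by apply: eq_integral => x _; apply/esym/cvg_lim.
have mup n : measurable_fun setT (fun x => (`|u n x| `^ p)%:E).
  by apply/measurable_EFinP; apply: measurable_powR_norm; exact: muT.
have up0 n x : setT x -> 0 <= (`|u n x| `^ p)%:E by rewrite lee_fin powR_ge0.
have und x : setT x -> {homo (fun n => (`|u n x| `^ p)%:E) : m n / (m <= n)%N >-> m <= n}.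
  move=> _ m n mn; rewrite lee_fin ge0_ler_powR ?nnegrE ?(ltW p0)// !uE.
  have [gm|gm] := leP `|g x|%R m%:R; last by rewrite normr0.
  by rewrite ifT// (le_trans gm)// ler_nat.
rewrite (monotone_convergence P measurableT mup up0 und).
apply: lime_le; last exact: nearW.
apply: ereal_nondecreasing_is_cvgn => m n mn.
by apply: ge0_le_integral => // x xT; exact: und.
Unshelve. all: by end_near.
Qed.

End conditional_expectation.

(** * Density of the filtration in L^p *)

Section Lp_norm.
Context (d : measure_display) (T : measurableType d) (R : realType).
Variables (P : probability T R) (p : R).
Hypothesis p1 : (1 <= p)%R.
Implicit Types f g h : T -> R.

Let p0 : (0 < p)%R. Proof. exact: lt_le_trans p1. Qed.
Let pn0 : p != 0%R. Proof. by rewrite gt_eqF. Qed.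

Lemma poweR_Lnorm_EFin f :
  'N[P]_(p%:E)[EFin \o f] `^ p = \int[P]_x (`|f x| `^ p)%:E.
Proof. by rewrite poweR_Lnorm. Qed.

Lemma Lnorm_lt f (e : R) : (0 < e)%R ->
  \int[P]_x (`|f x| `^ p)%:E < (e `^ p)%:E -> 'N[P]_(p%:E)[EFin \o f] < e%:E.
Proof.
move=> e0; rewrite -poweR_Lnorm_EFin -poweR_EFin; apply: contraTT.
rewrite -!leNgt => eN; apply: gt0_ler_poweR => //; first exact: ltW.
- by rewrite in_itv/= lee_fin (ltW e0) leey.
- by rewrite in_itv/= Lnorm_ge0 leey.
Qed.

Lemma Lnorm_scale f (c : R) : measurable_fun setT f ->
  'N[P]_(p%:E)[EFin \o (fun x => c * f x)%R] = `|c|%:E * 'N[P]_(p%:E)[EFin \o f].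
Proof.
move=> mf; rewrite unlock /=.
under eq_integral do rewrite normrM powRM// EFinM.
rewrite ge0_integralZl_EFin ?powR_ge0//; last first.
  by apply/measurable_EFinP; exact: measurable_powR_norm.
rewrite poweRM ?lee_fin ?powR_ge0//; last first.
  by apply: integral_ge0 => x _; rewrite lee_fin powR_ge0.
by rewrite poweR_EFin -powRrM mulfV// powRr1.
Qed.

(** Once [|l - u n| <= 1], the assumption [p >= 1] gives [|l - u n|^p <= |l - u n|], and squeezing
    concludes. *)
Lemma cvg_powR_norm (u : nat -> R) (l : R) : u @ \oo --> l ->
  (`|l - u n| `^ p)%R @[n --> \oo] --> 0%R.
Proof.
move=> ul; have ul0 : `|l - u n|%R @[n --> \oo] --> 0%R.
  rewrite -(@normr0 _ R) -(subrr l); apply: cvg_norm; apply: cvgB => //.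
  exact: cvg_cst.
apply: (@squeeze_cvgr _ _ _ _ (fun=> 0%R) (fun n => `|l - u n|%R)) => //; last first.
  exact: cvg_cst.
near=> n; rewrite powR_ge0/=.
have [->|un0] := eqVneq (l - u n)%R 0%R; first by rewrite normr0 powR0.
apply: ge1r_powR => //; rewrite normr_gt0 un0/=.
by near: n; apply: (cvgr_dist_le _ _ ul).
Unshelve. all: by end_near.
Qed.

(** Dominated convergence for [|f - f_n|^p], bounded by the integrable function
    [(2 |g|)^p = 2^p |g|^p]. *)
Lemma dominated_Lnorm_cvg (f_ : nat -> T -> R) f g :
  (forall n, measurable_fun setT (f_ n)) -> measurable_fun setT f ->
  P.-integrable setT (fun x => (`|g x| `^ p)%:E) ->
  (forall n x, `|f_ n x| <= `|g x|)%R -> (forall x, f_ ^~ x @ \oo --> f x) ->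
  forall e, (0 < e)%R -> exists n, 'N[P]_(p%:E)[EFin \o (f \- f_ n)%R] < e%:E.
Proof.
move=> mf_ mf intg f_g f_f e e0.
have fg x : (`|f x| <= `|g x|)%R.
  have nf : `|f_ n x|%R @[n --> \oo] --> `|f x|%R by exact: cvg_norm.
  rewrite -(cvg_lim _ nf)//; apply: limr_le; first by apply/cvg_ex; exists `|f x|%R.
  exact: nearW.
have [] // := @dominated_convergence _ _ _ P _ measurableT
  (fun n x => (`|f x - f_ n x| `^ p)%:E) (fun=> 0)
  (fun x => (2 `^ p)%:E * (`|g x| `^ p)%:E).
- move=> n; apply/measurable_EFinP/measurable_powR_norm; exact: measurable_funB.
- by apply: aeW => x _; apply: cvg_EFin; [exact: nearW|exact: cvg_powR_norm].
- exact: integrableZl.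
- apply: aeW => x n _; rewrite gee0_abs ?lee_fin ?powR_ge0//.
  rewrite -powRM// ge0_ler_powR ?nnegrE ?(ltW p0)//.
  by rewrite (le_trans (ler_normB _ _))// mulr_natl mulr2n lerD.
move=> _ _; rewrite integral0 => cvg0.
have : nbhs 0 [set y | y < (e `^ p)%:E].
  apply: open_nbhs_nbhs; split; first exact: open_ereal_lt_ereal.
  by rewrite /= lte_fin powR_gt0.
by move=> /cvg0[n _ /(_ n (leqnn n))] /= lt_e; exists n; exact: Lnorm_lt.
Qed.
End Lp_norm.

(** By monotonicity two sets of the union lie in a common stage. The union is thus a pi-system, as
    the pi-lambda theorem demands. *)
Lemma setIC_filtration d (T : measurableType d) (F : nat -> set (set T)) :
  is_filtration F -> setI_closed (\bigcup_k F k).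
Proof.
move=> hF A B [m _ FA] [n _ FB]; exists (maxn m n) => //.
have mono := filtration_nondecreasing hF.
have /sigma_algebraP [] := filtration_sigma_algebra hF (maxn m n) => // _ _ _ FI.
by apply: FI; [apply: mono FA|apply: mono FB]; rewrite ?leq_maxl ?leq_maxr.
Qed.

Section Lp_approximation.
Context (d : measure_display) (T : measurableType d) (R : realType).
Variables (P : probability T R) (p : R) (F : nat -> set (set T)).
Hypotheses (p1 : (1 <= p)%R) (hF : is_filtration F).
Implicit Types f g h : T -> R.

Let p0 : (0 < p)%R. Proof. exact: lt_le_trans p1. Qed.

(** The L^p closure of the functions measurable at a finite stage, as a predicate on one function so
    that it can be the invariant of the pi-lambda argument and of the functional induction. *)
Definition Lp_approx f := forall e, (0 < e)%R -> exists k h,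
  measurable_fun setT (h : g_sigma_algebraType (F k) -> R) /\
  'N[P]_(p%:E)[EFin \o (f \- h)%R] < e%:E.

Lemma filtration_measurable_fun k f :
  measurable_fun setT (f : g_sigma_algebraType (F k) -> R) ->
  measurable_fun setT f.
Proof.
apply: measurable_fun_g_sigma_algebra.
- exact: filtration_sigma_algebra.
- exact: filtration_measurable.
Qed.

Lemma filtration_measurable_fun_le m n f : (m <= n)%N ->
  measurable_fun setT (f : g_sigma_algebraType (F m) -> R) ->
  measurable_fun setT (f : g_sigma_algebraType (F n) -> R).
Proof.
move=> mn mf _ Y mY.
apply: sub_sigma_algebra; apply: (filtration_nondecreasing hF mn).
apply: (measurable_g_sigma_algebra (filtration_sigma_algebra hF m)).
exact: mf.
Qed.

Lemma Lnorm_triangle f g h : measurable_fun setT f -> measurable_fun setT g ->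
  measurable_fun setT h ->
  'N[P]_(p%:E)[EFin \o (f \- h)%R] <=
  'N[P]_(p%:E)[EFin \o (f \- g)%R] + 'N[P]_(p%:E)[EFin \o (g \- h)%R].
Proof.
move=> mf mg mh.
rewrite (_ : (f \- h)%R = ((f \- g) \+ (g \- h))%R); last first.
  by apply/funext => x /=; rewrite subrKA.
by apply: minkowski_EFin => //; exact: measurable_funB.
Qed.

(** Half of [e] is spent on each approximation. This closedness handles increasing unions,
    modifications on null sets and dominated limits. *)
Lemma Lp_approx_lim f : measurable_fun setT f ->
  (forall e, (0 < e)%R -> exists g, [/\ measurable_fun setT g, Lp_approx g &
    'N[P]_(p%:E)[EFin \o (f \- g)%R] < e%:E]) ->
  Lp_approx f.
Proof.
move=> mf flim e e0; have e20 : (0 < e / 2)%R by rewrite divr_gt0.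
have [g [mg ag fg]] := flim _ e20; have [k [h [mh gh]]] := ag _ e20.
exists k, h; split => //.
apply: (le_lt_trans (Lnorm_triangle mf mg (filtration_measurable_fun mh))).
by rewrite (splitr e) EFinD lteD.
Qed.

Lemma Lp_approxD f g : measurable_fun setT f -> measurable_fun setT g ->
  Lp_approx f -> Lp_approx g -> Lp_approx (f \+ g)%R.
Proof.
move=> mf mg af ag e e0; have e20 : (0 < e / 2)%R by rewrite divr_gt0.
have [k [h [mh fh]]] := af _ e20; have [l [h' [mh' gh']]] := ag _ e20.
exists (maxn k l), (h \+ h')%R; split.
  by apply: measurable_funD; [apply: filtration_measurable_fun_le mh|
    apply: filtration_measurable_fun_le mh']; rewrite ?leq_maxl ?leq_maxr.
have -> : ((f \+ g) \- (h \+ h') = (f \- h) \+ (g \- h'))%R.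
  by apply/funext => x /=; ring.
rewrite (splitr e) EFinD (le_lt_trans (minkowski_EFin _ _ _ p1))// ?lteD//.
- exact: measurable_funB (filtration_measurable_fun mh).
- exact: measurable_funB (filtration_measurable_fun mh').
Qed.

Lemma Lp_approxZ c f : measurable_fun setT f ->
  Lp_approx f -> Lp_approx (fun x => c * f x)%R.
Proof.
(* The added 1 keeps the divisor positive when [c = 0]. *)
move=> mf af e e0; have c0 : (0 < `|c| + 1)%R by rewrite ltr_wpDl.
have [k [h [mh fh]]] := af (e / (`|c| + 1))%R (divr_gt0 e0 c0).
exists k, (fun x => c * h x)%R; split; first exact: measurable_funM.
rewrite (_ : (_ \- _)%R = (fun x => c * (f \- h) x)%R); last first.
  by apply/funext => x /=; rewrite mulrBr.
rewrite Lnorm_scale//; last exact: measurable_funB (filtration_measurable_fun mh).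
apply: (@le_lt_trans _ _ ((`|c| + 1)%:E * 'N[P]_(p%:E)[EFin \o (f \- h)%R])).
  by apply: lee_wpmul2r; rewrite ?Lnorm_ge0// lee_fin lerDl.
by rewrite -lte_pdivlMl// -EFinM mulrC.
Qed.

(** Pi-lambda theorem: the measurable sets with approximable indicator form a lambda-system
    containing every [F k]. Measurability is carried along because the closure properties of
    [Lp_approx] need it. *)
Lemma Lp_approx_generated A : <<s \bigcup_k F k >> A ->
  measurable A /\ Lp_approx \1_A.
Proof.
pose D := [set A : set T | measurable A /\ Lp_approx \1_A].
apply: (@lambda_system_subset _ (\bigcup_k F k) _ setT D) => //.
- exact: setIC_filtration.
- split => //.
  + split => // e e0; exists 0%N, (cst 1%R); split => //.
    rewrite (_ : (_ \- _)%R = cst 0%R); first by rewrite Lnorm0 ?gt_eqF.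
    by apply/funext => x /=; rewrite indicT subrr.
  + move=> B C CB [mB aB] [mC aC]; split; first exact: measurableD.
    rewrite (_ : \1_(B `\` C) = \1_B \+ (fun x => -1 * \1_C x))%R.
      apply: Lp_approxD => //; last exact: Lp_approxZ.
      by apply: measurable_funM.
    apply/funext => x /=; rewrite !indicE in_setD.
    have [/set_mem/CB xB|] := boolP (x \in C).
      by rewrite (mem_set xB) mulr1 subrr.
    by rewrite andbT mulr0 addr0.
  + move=> B Bnd DB.
    have mU : measurable (\bigcup_i B i) by apply: bigcup_measurable => i _; case: (DB i).
    split => //; apply: Lp_approx_lim => // e e0.
    (* The indicators of an increasing union converge pointwise below the constant 1, which is
       integrable for a probability. *)
    have [] := @dominated_Lnorm_cvg _ _ _ P p p1 (fun n => \1_(B n))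
      \1_(\bigcup_i B i) (cst 1%R) _ _ _ _ _ e e0.
    * by move=> n; case: (DB n) => *; exact: measurable_indic.
    * exact: measurable_indic.
    * under eq_fun do rewrite normr1 powR1.
      exact: finite_measure_integrable_cst.
    * by move=> n x; rewrite normr1 ger0_norm// indicE; case: (_ \in _).
    * move=> x; apply: cvg_near_cst.
      have [[i _ Bi]|nB] := pselect ((\bigcup_i B i) x).
        near=> n; rewrite !indicE !mem_set//; first by exists i.
        have : (i <= n)%N by near: n; exact: nbhs_infty_ge.
        by move=> /Bnd/subsetPset; apply.
      apply: nearW => n; rewrite !indicE !memNset// => Bn; apply: nB.
      by exists n.
    * move=> n lt_e; exists \1_(B n); split => //; case: (DB n) => // *.
- move=> B [k _ FB]; have mB := filtration_measurable hF FB.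
  split => // e e0; exists k, \1_B; split.
    by apply: measurable_indic; exact: sub_sigma_algebra.
  rewrite (_ : (_ \- _)%R = cst 0%R); first by rewrite Lnorm0 ?gt_eqF.
  by apply/funext => x /=; rewrite subrr.
Unshelve. all: by end_near.
Qed.

Hypothesis hFoo : generates_mod_null P (\bigcup_k F k).

(** For a generated set [B] equal to [A] up to a null set, [|1_A - 1_B|^p] is the indicator of the
    null set [A + B] (symmetric difference), so the two indicators are at L^p distance 0. *)
Lemma Lp_approx_indic A : measurable A -> Lp_approx \1_A.
Proof.
move=> mA; have [B sB AB0] := hFoo mA; have [mB aB] := Lp_approx_generated sB.
apply: Lp_approx_lim => // e e0; exists \1_B; split => //.
apply: Lnorm_lt => //.
rewrite (_ : \int[P]_x _ = \int[P]_x (\1_(A `+` B) x)%:E); last first.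
  apply: eq_integral => x _; congr EFin; rewrite /= !indicE /setY in_setU !in_setD.
  case: (x \in A); case: (x \in B) => /=;
    by rewrite ?subrr ?subr0 ?sub0r ?normrN ?normr0 ?normr1 ?powR1// powR0// gt_eqF.
rewrite integral_indic// ?setIT; last by apply: measurableU; exact: measurableD.
by rewrite [X in X < _]AB0 lte_fin powR_gt0.
Qed.

(** Functional induction starting from indicators. In the limit step the sequence is dominated by
    [|f|], whose [p]-th power is integrable, so pointwise convergence becomes L^p convergence. *)
Lemma Lp_approx_Lfun f : f \in Lfun P p%:E -> Lp_approx f.
Proof.
move=> fp; have mf : measurable_fun setT f by move: fp; rewrite inE => /andP[/[!inE]].
suff [] : measurable_fun setT f /\ Lp_approx f by [].
apply: (@measurable_fun_ind _ _ _ (fun f => measurable_fun setT f /\ Lp_approx f)) => //.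
- by move=> A mA; split => //; exact: Lp_approx_indic.
- by move=> g h [? ?] [? ?]; split; [exact: measurable_funD|exact: Lp_approxD].
- by move=> c g [? ?]; split; [exact: measurable_funM|exact: Lp_approxZ].
- move=> f_ mf_ af_ f_f cf; split => //; apply: Lp_approx_lim => // e e0.
  have [n fn] := dominated_Lnorm_cvg p1 mf_ mf (Lfun_integrable p1 fp) f_f cf e0.
  by exists (f_ n); split => //; case: (af_ n).
Qed.
End Lp_approximation.

(** * Convergence of the norms *)

(** A [G]-measurable integrable [h] is its own conditional expectation, so this is linearity. It
    lets the contraction property bound [E m - h] by [f - h]. *)
Lemma cond_exp_subr d (T : measurableType d) (R : realType)
    (P : probability T R) (G : set (set T)) (f g h : T -> R) :
  sigma_algebra setT G -> G `<=` measurable ->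
  is_cond_exp P G f g -> P.-integrable setT (EFin \o f) ->
  measurable_fun setT (h : g_sigma_algebraType G -> R) ->
  P.-integrable setT (EFin \o h) ->
  is_cond_exp P G (f \- h)%R (g \- h)%R.
Proof.
move=> sG mG [mg intg gf] intf mh inth; split.
- exact: measurable_funB.
- have -> : EFin \o (g \- h)%R = (EFin \o g) \- (EFin \o h) by exact/funext.
  exact: integrableB.
- move=> A GA; have mA := mG _ GA.
  have sub k : P.-integrable setT (EFin \o k) -> \int[P]_(x in A) ((k \- h)%R x)%:E =
      \int[P]_(x in A) (k x)%:E - \int[P]_(x in A) (h x)%:E.
    move=> intk; rewrite -integralB//.
    - exact: integrableS intk.
    - exact: integrableS inth.
  by rewrite !sub// gf.
Qed.

Section cond_exp_norm_cvg.
Context (R : realType) (p : R) (d : measure_display) (T : measurableType d).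
Context (P : probability T R) (F : nat -> set (set T)) (f : T -> R).
Context (E : nat -> T -> R).
Hypotheses (p1 : (1 <= p)%R) (hF : is_filtration F).
Hypothesis hFoo : generates_mod_null P (\bigcup_k F k).
Hypothesis fp : f \in Lfun P p%:E.
Hypothesis hE : forall k, is_cond_exp P (F k) f (E k).

Let p0 : (0 < p)%R. Proof. exact: lt_le_trans p1. Qed.

(** L^p is contained in L^1 because the total mass is finite and [p >= 1]. *)
Lemma Lfun_probability_integrable g : g \in Lfun P p%:E ->
  P.-integrable setT (EFin \o g).
Proof.
move=> gp; apply/Lfun1_integrable.
apply: (@Lfun_subset _ _ _ P 1 p%:E) gp; rewrite ?lee_fin ?p1//.
exact: fin_num_measure.
Qed.

Lemma cond_exp_Lnorm_le k g h : g \in Lfun P p%:E -> is_cond_exp P (F k) g h ->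
  'N[P]_(p%:E)[EFin \o h] <= 'N[P]_(p%:E)[EFin \o g].
Proof.
move=> gp gh.
have := cond_exp_Lp_le (filtration_sigma_algebra hF k) (@filtration_measurable _ _ _ hF k)
  p1 gh (Lfun_probability_integrable gp) (Lfun_integrable p1 gp).
move=> le_int; rewrite unlock /=; apply: gt0_ler_poweR => //.
- by rewrite invr_ge0 ltW.
- by rewrite in_itv/= leey andbT integral_ge0// => x _; rewrite lee_fin powR_ge0.
- by rewrite in_itv/= leey andbT integral_ge0// => x _; rewrite lee_fin powR_ge0.
Qed.

(** Go from [f] to [h], then to [E m], then to 0 by the triangle inequality. The first two distances
    are each below [e / 2], the second by contraction applied to [f - h]. *)
Lemma cond_exp_Lnorm_ge e : (0 < e)%R -> exists k, forall m, (k <= m)%N ->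
  'N[P]_(p%:E)[EFin \o f] <= 'N[P]_(p%:E)[EFin \o E m] + e%:E.
Proof.
move=> e0; have e20 : (0 < e / 2)%R by rewrite divr_gt0.
have [k [h [mh fh]]] := Lp_approx_Lfun p1 hF hFoo fp e20.
exists k => m km; have mhm := filtration_measurable_fun_le hF km mh.
have mhT := filtration_measurable_fun hF mh.
have mf : measurable_fun setT f by move: fp; rewrite inE => /andP[/[!inE]].
have fhp : (f \- h)%R \in Lfun P p%:E.
  rewrite inE; apply/andP; split; rewrite inE; first exact: measurable_funB.
  by rewrite /= /finite_norm (lt_le_trans fh)// leey.
(* The approximation places [f - h] in L^p; [h] is then a difference of two L^p functions. *)
have hp : h \in Lfun P p%:E.
  rewrite (_ : h = f - (f \- h))%R; last by apply/funext => x; rewrite /= !fctE subKr.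
  by rewrite rpredB.
have mE : measurable_fun setT (E m).
  exact: (filtration_measurable_fun hF (cond_exp_measurable (hE m))).
have Eh := cond_exp_subr (filtration_sigma_algebra hF m)
  (@filtration_measurable _ _ _ hF m) (hE m) (Lfun_probability_integrable fp) mhm
  (Lfun_probability_integrable hp).
have Ehle := cond_exp_Lnorm_le fhp Eh.
(* Norms are rewritten as distances to the zero function, so that [Lnorm_triangle] covers every link
   of the chain. *)
have fE : (f = f \- (fun=> 0))%R by apply/funext => x /=; rewrite subr0.
have m0 : measurable_fun setT (fun _ : T => 0 : R)%R by exact: measurable_cst.
have -> : EFin \o f = EFin \o (f \- (fun=> 0))%R by rewrite -fE.
apply: (le_trans (Lnorm_triangle P p1 mf mhT m0)).
have := Lnorm_triangle P p1 mhT mE m0.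
have -> : (E m \- (fun=> 0) = E m)%R by apply/funext => x /=; rewrite subr0.
have -> : 'N[P]_(p%:E)[EFin \o (h \- E m)%R] = 'N[P]_(p%:E)[EFin \o (E m \- h)%R].
  rewrite -oppe_Lnorm; congr Lnorm; apply/funext => x /=.
  by rewrite opprB.
move=> /le_trans/(_ (leeD (le_trans Ehle (ltW fh)) (lexx _))) h_le.
apply: (le_trans (leeD (ltW fh) h_le)).
by rewrite addeA -EFinD -splitr addeC.
Qed.

End cond_exp_norm_cvg.

Unset Implicit Arguments.
Set Strict Implicit.

Theorem mainTheorem7 (R : realType) (p : R) (hp : (1 <= p)%R)
  (d : measure_display) (T : measurableType d) (P : probability T R)
  (F : nat -> set (set T)) (hF : is_filtration F)
  (hFoo : generates_mod_null P (\bigcup_k F k))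
  (f : T -> R) (hf : f \in Lfun P p%:E)
  (E : nat -> T -> R) (hE : forall k, is_cond_exp P (F k) f (E k)) :
  (1 - expR (- beta))%:E *
    (\sum_(0 <= k <oo)
       (expR (- beta * k%:R))%:E * 'N[P]_(p%:E)[EFin \o E k] `^ p)
    @[beta --> (0%R : R)^'+]
  --> 'N[P]_(p%:E)[EFin \o f] `^ p.
Proof.
have p0 : (0 < p)%R by exact: lt_le_trans hp.
have Nfin : 'N[P]_(p%:E)[EFin \o f] \is a fin_num.
  rewrite ge0_fin_numE ?Lnorm_ge0//.
  by move: hf; rewrite inE => /andP[_]; rewrite inE.
have Ele k := cond_exp_Lnorm_le hp hF hf (hE k).
have Efin k : 'N[P]_(p%:E)[EFin \o E k] \is a fin_num.
  by rewrite ge0_fin_numE ?Lnorm_ge0// (le_lt_trans (Ele k))// -ge0_fin_numE ?Lnorm_ge0.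
pose n0 := fine 'N[P]_(p%:E)[EFin \o f].
pose N k := fine 'N[P]_(p%:E)[EFin \o E k].
have NE k : 'N[P]_(p%:E)[EFin \o E k] = (N k)%:E by rewrite fineK.
have n0E : 'N[P]_(p%:E)[EFin \o f] = n0%:E by rewrite fineK.
have N0 k : (0 <= N k)%R by rewrite fine_ge0 ?Lnorm_ge0.
have n00 : (0 <= n0)%R by rewrite fine_ge0 ?Lnorm_ge0.
rewrite n0E poweR_EFin; apply: abel_mean_cvg => [k|k|e e0].
- exact: poweR_ge0.
- rewrite NE poweR_EFin lee_fin ge0_ler_powR ?nnegrE ?(ltW p0)//.
  by rewrite -lee_fin -NE -n0E.
(* [c] is the slope of the tangent to [t^p] at [n0]. The graph lies above that tangent, so
   [N m >= n0 - e / (c + 1)] costs at most [c e / (c + 1) <= e] on [p]-th powers; the added 1 covers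
   [c = 0]. *)
pose c := (p * n0 `^ (p - 1))%R.
have c0 : (0 <= c)%R by rewrite mulr_ge0 ?powR_ge0// ltW.
have c10 : (0 < c + 1)%R by rewrite ltr_wpDl.
have [k kN] := cond_exp_Lnorm_ge hp hF hFoo hf hE (divr_gt0 e0 c10).
exists k => m /kN; rewrite NE n0E -EFinD lee_fin => n0N.
rewrite poweR_EFin lee_fin.
have := powR_tangent hp (N0 m) n00; rewrite -/c.
have cn0 : (c * n0 = p * n0 `^ p)%R by rewrite /c -mulrA (mulrC _ n0) mulr_powRB1.
have : (c * n0 <= c * (N m + e / (c + 1)))%R by rewrite ler_wpM2l.
have : (c * (e / (c + 1)) <= e)%R.
  by rewrite mulrA ler_pdivrMr// mulrDr mulr1 mulrC lerDl ltW.
by rewrite cn0; lra.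
Qed.
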